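(* Let $r\le s<n$ be nonnegative integers and let $\mathrm{Pan}_{r,s,n}$ be the panhandle matroid. Then for every nonnegative integer $t$, \[ \mathrm{ehr}_{\mathrm{Pan}_{r,s,n}}(t)=\sum_{m=0}^t\sum_{i=0}^{s-r}(-1)^i\binom{s}{i}\binom{t(s-r-i)+m+s-1-i}{s-1}\binom{m+n-s-1}{m}. \]
   Context: For $r\le s<n$, the panhandle matroid $\mathrm{Pan}_{r,s,n}$ is the rank-$r$ matroid on ground set $[n]=\{1,\dots,n\}$ whose bases are the $r$-subsets $B\subseteq[n]$ with $|B\cap[s]|\ge r-1$. The base polytope of a matroid $M$ on $[n]$ is $\mathcal{P}_M=\mathrm{conv}\{\mathbf{e}_B: B \text{ a basis}\}\subset\mathbb{R}^n$, where $\mathbf{e}_B=\sum_{i\in B}\mathbf{e}_i$. The Ehrhart polynomial is $\mathrm{ehr}_M(t)=|t\mathcal{P}_M\cap\mathbb{Z}^n|$ for nonnegative integers $t$. *)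

(* Defs.v *)
From HB Require Import structures.
From mathcomp Require Import all_boot all_order all_algebra.

Set Implicit Arguments.
Unset Strict Implicit.
Unset Printing Implicit Defensive.

Import Order.TTheory GRing.Theory Num.Theory.
Local Open Scope ring_scope.

Record matroid (E : finType) := Matroid {
  bases : {set {set E}};
  bases_neq0 : bases != set0;
  bases_exchange : forall (A B : {set E}) (x : E),
    A \in bases -> B \in bases -> x \in A :\: B ->
    exists2 y, y \in B :\: A & y |: (A :\ x) \in bases }.

Section Panhandle.
Variables (r s n : nat).

(* The elements 1, ..., s of the ground set are the i : 'I_n with i < s. *)
Definition initial_segment : {set 'I_n} := [set i : 'I_n | (i < s)%N].

(* #|B :&: [s]| >= r - 1, written so as not to truncate when r = 0. *)
Definition pan_bases : {set {set 'I_n}} :=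
  [set B : {set 'I_n} |
    (#|B| == r) && (r <= #|B :&: initial_segment|.+1)%N].

Hypotheses (le_rs : (r <= s)%N) (lt_sn : (s < n)%N).

Lemma pan_bases_neq0 : pan_bases != set0.
Proof.
have le_rn : (r <= n)%N by rewrite (leq_trans le_rs) // ltnW.
apply/set0Pn; exists [set widen_ord le_rn i | i : 'I_r].
rewrite inE; have cB : #|[set widen_ord le_rn i | i : 'I_r]| = r.
  rewrite card_imset ?card_ord // => i j /(congr1 val) /= ij; exact: val_inj.
rewrite cB eqxx /= (setIidPl _) ?cB //.
apply/subsetP => _ /imsetP[i _ ->]; rewrite inE /=.
exact: leq_trans (ltn_ord i) le_rs.
Qed.

Lemma pan_bases_exchange (A B : {set 'I_n}) (x : 'I_n) :
  A \in pan_bases -> B \in pan_bases -> x \in A :\: B ->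
  exists2 y, y \in B :\: A & y |: (A :\ x) \in pan_bases.
Proof.
rewrite !inE => /andP[/eqP cA hA] /andP[/eqP cB hB] /andP[xB xA].
set S := initial_segment in hA hB *.
have cAx : #|A :\ x|.+1 = r by rewrite -cA (cardsD1 x A) xA.
have key y : y \in B :\: A -> (r <= #|(y |: (A :\ x)) :&: S|.+1)%N ->
    exists2 y, y \in B :\: A & y |: (A :\ x) \in pan_bases.
  move=> yBA h; exists y => //; rewrite inE h andbT.
  move: yBA; rewrite inE => /andP[yA _].
  by rewrite cardsU1 !inE (negPf yA) andbF add1n cAx.
have [le_r|lt_r] := leqP r #|(A :\ x) :&: S|.+1.
  have /set0Pn[y yBA] : B :\: A != set0.
    rewrite -card_gt0 cardsD cB subn_gt0 -cA.
    have : B :&: A \subset A :\ x.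
      apply/subsetP => z; rewrite !inE => /andP[zB ->]; rewrite andbT.
      by apply: contraNneq xB => <-.
    by move/subset_leq_card => h; rewrite (leq_ltn_trans h) // cA cAx.
  apply: (key y yBA); apply: leq_trans le_r _; rewrite ltnS.
  by apply/subset_leq_card/setSI/subsetUr.
have /subsetPn[y] : ~~ (B :&: S \subset (A :\ x) :&: S).
  apply/negP => /subset_leq_card h.
  by move: (leq_trans hB (h : (#|_|.+1 <= #|_|.+1)%N)); rewrite leqNgt lt_r.
rewrite !inE => /andP[yB yS]; rewrite yS andbT negb_and negbK => yAx.
have yx : y != x by apply: contraNneq xB => <-.
rewrite (negPf yx) /= in yAx.
apply: (key y); first by rewrite !inE yAx yB.
have -> : (y |: (A :\ x)) :&: S = y |: ((A :\ x) :&: S).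
  by apply/setP => z; rewrite !inE; case: eqP => // ->; rewrite yS.
rewrite cardsU1 !inE (negPf yAx) !andbF add1n.
suff : (#|A :&: S| <= #|(A :\ x) :&: S|.+1)%N 
  by move=> h; apply: leq_trans hA _; rewrite ltnS.
rewrite setIDAC (cardsD1 x (A :&: S)) -add1n leq_add2r.
by case: (_ \in _).
Qed.

Definition pan : matroid 'I_n := Matroid pan_bases_neq0 pan_bases_exchange.

End Panhandle.

From mathcomp Require Import finmap boolp classical_sets cardinality reals convex.

Section Ehrhart.
Variables (R : realType) (n : nat).
Local Open Scope classical_set_scope.

Definition convex_hull (X : set 'rV[R]_n) : set 'rV[R]_n :=
  smallest (@convex_set R 'rV[R]_n) X.

Definition indicator_vector (B : {set 'I_n}) : 'rV[R]_n :=
  \sum_(i in B) delta_mx 0 i.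

Definition base_polytope (M : matroid 'I_n) : set 'rV[R]_n :=
  convex_hull [set indicator_vector B | B in [set B | B \in bases M]].

Definition lattice_points (X : set 'rV[R]_n) : set 'rV[int]_n :=
  [set z | X (map_mx intr z)].

(* [fset_set] is the empty set on infinite sets, but base polytopes are
   bounded, so that this is the actual number of lattice points. *)
Definition ehrhart (M : matroid 'I_n) (t : nat) : nat :=
  #|` fset_set (lattice_points [set t%:R *: x | x in base_polytope M]) |.

End Ehrhart.

(* Binomial coefficients with integer arguments: a! / (b! (a - b)!) when
   0 <= b <= a, and otherwise 0, except that binz a a = 1 also for a < 0.  Under
   this convention binz (k + s - 1) (s - 1) is the number of families of s
   nonnegative integers with sum k for every k : int and every s : nat, even
   s = 0 (only the sum 0 is attained, by the empty family) or k < 0 (no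
   family). *)
Definition binz (a b : int) : int :=
  match a, b with
  | Posz m, Posz k => 'C(m, k)%:Z
  | _, _ => (a == b)%:Z
  end.

(* Main.v *)
Require Import Defs.
From mathcomp Require Import all_boot all_order all_algebra.
From mathcomp Require Import zify ring.

Import Order.TTheory GRing.Theory Num.Theory.
Local Open Scope ring_scope.

(* The lattice points of the dilate by t are the integer vectors with entries
   in [0, t], sum t r and sum of the last n - s entries at most t: these linear
   conditions hold on the vertices, and conversely such a vector is a sum of t
   indicator vectors of bases, which are peeled off one at a time by rounding
   the averages of the head and of the tail.  Fixing the sum m of the tail, the
   tail is an arbitrary weak composition of m.  Replacing each head entry z by
   t - z leaves the weak compositions of t (s - r) + m into s parts at most t,
   which inclusion-exclusion counts. *)

(** * Weak compositions and Pascal's rule *)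

Definition weak_compositions (s : nat) (k : int) : int :=
  binz (k + s%:Z - 1) (s%:Z - 1).

(** For a < 0 all three terms vanish, even at a = -1, where a + 1 = 0: the lower index on the left
    is positive. *)
Lemma binz_pascal (a : int) (b : nat) :
  binz (a + 1) b.+1%:Z = binz a b.+1%:Z + binz a b%:Z.
Proof.
case: a => [m|[|m]] //.
by rewrite -[m%:Z + 1]/((m + 1)%N%:Z) addn1 /= binS PoszD.
Qed.

Lemma binz_neg (a : int) (b : nat) : a < 0 -> binz a b%:Z = 0.
Proof. by case: a. Qed.

Lemma weak_compositions0 (k : int) : weak_compositions 0 k = (k == 0)%:Z.
Proof.
rewrite /weak_compositions addr0 add0r.
by case: k => [[|m]|m].
Qed.

Lemma weak_compositions_neg (s : nat) (k : int) :
  k < 0 -> weak_compositions s k = 0.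
Proof.
case: s => [|s] k_lt0; first by rewrite weak_compositions0 lt_eqF.
rewrite /weak_compositions.
have -> : s.+1%:Z - 1 = s%:Z by lia.
have -> : k + s.+1%:Z - 1 = k + s%:Z by lia.
case: k k_lt0 => // k _; case: (ltrP (Negz k + s%:Z) 0) => [|ks_ge0].
  exact: binz_neg.
have -> : Negz k + s%:Z = (s - k.+1)%N%:Z by lia.
by rewrite /= bin_small //; lia.
Qed.

Lemma weak_compositionsS (s : nat) (k : int) :
  weak_compositions s.+1 k
    = weak_compositions s.+1 (k - 1) + weak_compositions s k.
Proof.
case: s => [|s].
  rewrite weak_compositions0 /weak_compositions.
  rewrite subrr !addrK; case: k => [[|m]|m] //.
  have -> : m.+1%:Z - 1 = m%:Z by lia.
  by rewrite -[LHS]/('C(m.+1, 0)%:Z) -[binz m 0]/('C(m, 0)%:Z) !bin0 addr0.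
have := binz_pascal (k + s%:Z) s; rewrite /weak_compositions.
have -> : s.+2%:Z - 1 = s.+1%:Z by lia.
have -> : s.+1%:Z - 1 = s%:Z by lia.
have -> : k + s.+2%:Z - 1 = k + s%:Z + 1 by lia.
have -> : k - 1 + s.+2%:Z - 1 = k + s%:Z by lia.
by have -> : k + s.+1%:Z - 1 = k + s%:Z by lia.
Qed.

(** Telescopes [weak_compositionsS]. *)
Lemma sum_weak_compositions (p s : nat) (k : int) :
  \sum_(j < p) weak_compositions s (k - j%:Z)
    = weak_compositions s.+1 k - weak_compositions s.+1 (k - p%:Z).
Proof.
elim: p => [|p IHp]; first by rewrite big_ord0 subr0 subrr.
rewrite big_ord_recr /= IHp.
rewrite [weak_compositions s.+1 (k - p%:Z)]weak_compositionsS.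
have -> : k - p%:Z - 1 = k - p.+1%:Z by lia.
ring.
Qed.

(** * Compositions with bounded parts, by inclusion-exclusion *)

Definition weight {p s : nat} (u : 'rV['I_p]_s) : int := \sum_j (u 0 j)%:Z.

(** Parts are strictly below p, so the bound t is expressed by p = t.+1. *)
Definition bounded_compositions (p s : nat) (k : int) : int :=
  \sum_(u : 'rV['I_p]_s) (weight u == k)%:Z.

Lemma big_row_split (T : finType) (a b : nat)
    (F : 'rV[T]_a -> 'rV[T]_b -> int) :
  \sum_(u : 'rV[T]_(a + b)) F (lsubmx u) (rsubmx u) = \sum_v \sum_w F v w.
Proof.
rewrite pair_bigA /= (reindex (fun v : 'rV[T]_a * 'rV[T]_b => row_mx v.1 v.2)).
  by apply: eq_bigr => -[v w] _; rewrite row_mxKl row_mxKr.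
exists (fun u => (lsubmx u, rsubmx u)) => [[v w] _|u _] /=.
  by rewrite row_mxKl row_mxKr.
exact: hsubmxK.
Qed.

Lemma weight_split (p a b : nat) (u : 'rV['I_p]_(a + b)) :
  weight u = weight (lsubmx u) + weight (rsubmx u).
Proof.
rewrite /weight big_split_ord.
by congr (_ + _); apply: eq_bigr => j _; rewrite mxE.
Qed.

Lemma bounded_compositionsS (p s : nat) (k : int) :
  bounded_compositions p s.+1 k
    = \sum_(j < p) bounded_compositions p s (k - j%:Z).
Proof.
rewrite /bounded_compositions.
under eq_bigr => u _ do rewrite (@weight_split p 1 s u).
rewrite (@big_row_split _ 1 s (fun v w => (weight v + weight w == k)%:Z)).
rewrite (reindex (fun j : 'I_p => const_mx j : 'rV_1)); last first.
  exists (fun v : 'rV_1 => v 0 0) => [j _|v _]; first by rewrite mxE.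
  by apply/rowP => i; rewrite mxE ord1.
apply: eq_bigr => j _; apply: eq_bigr => w _.
rewrite {1}/weight big_ord1 mxE; congr (nat_of_bool _)%:Z; lia.
Qed.

(** The coefficient of x^i in (1 - x)^s; [signed_binS] is multiplication by 1 - x. *)
Definition signed_bin (s i : nat) : int := (-1) ^+ i * 'C(s, i)%:Z.

Lemma signed_bin0 (s : nat) : signed_bin s 0 = 1.
Proof. by rewrite /signed_bin bin0. Qed.

Lemma signed_bin_small (s i : nat) : (s < i)%N -> signed_bin s i = 0.
Proof. by move=> lt_si; rewrite /signed_bin bin_small // mulr0. Qed.

Lemma signed_binS (s i : nat) :
  signed_bin s.+1 i.+1 = signed_bin s i.+1 - signed_bin s i.
Proof. by rewrite /signed_bin binS PoszD exprS; ring. Qed.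

(** The generating function is ((1 - x^p) / (1 - x))^s. Each further part contributes one factor:
    the division by 1 - x is the telescoping sum, the numerator is [signed_binS]. *)
Lemma bounded_compositionsE (p s : nat) (k : int) :
  bounded_compositions p s k =
  \sum_(0 <= i < s.+1)
    signed_bin s i * weak_compositions s (k - i%:Z * p%:Z).
Proof.
elim: s k => [|s IHs] k.
  rewrite big_nat1 signed_bin0 mul0r subr0 mul1r weak_compositions0.
  rewrite /bounded_compositions.
  under eq_bigr => u _ do rewrite /weight big_ord0.
  by rewrite sumr_const card_mx mul1n expn0 mulr1n eq_sym.
rewrite bounded_compositionsS.
under eq_bigr => j _ do rewrite IHs.
rewrite exchange_big /=.
under eq_bigr => i _.
  under eq_bigr => j _ do rewrite addrAC.
  rewrite -mulr_sumr sum_weak_compositions mulrBr; over.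
(* Subtracting one more p raises the index by one, so once the terms at i = 0 are split off the two
   sums recombine by [signed_binS]. *)
rewrite sumrB [X in X - _ = _]big_nat_recl // [in RHS]big_nat_recl //=.
rewrite !signed_bin0 -addrA.
congr (_ + _); under [RHS]eq_bigr => i _ do rewrite signed_binS mulrBl.
rewrite sumrB [in RHS]big_nat_recr //= signed_bin_small // mul0r addr0.
congr (_ - _); apply: eq_bigr => i _; congr (_ * weak_compositions _ _).
by rewrite -addn1 PoszD; ring.
Qed.

Lemma bounded_compositions_rev (t s : nat) (k : int) :
  bounded_compositions t.+1 s k = bounded_compositions t.+1 s (t%:Z * s%:Z - k).
Proof.
have inv : involutive (map_mx (@rev_ord t.+1) : 'rV_s -> 'rV_s).
  by move=> u; apply/rowP => i; rewrite !mxE rev_ordK.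
rewrite /bounded_compositions (reindex_inj (inv_inj inv)) /=.
apply: eq_bigr => u _; congr (nat_of_bool _)%:Z.
have -> : weight (map_mx (@rev_ord t.+1) u) = t%:Z * s%:Z - weight u.
  rewrite /weight; under eq_bigr => j _.
    rewrite mxE /= subSS -subzn ?leq_ord //; over.
  by rewrite sumrB sumr_const card_ord -mulr_natr natz.
lia.
Qed.

(** The bound t cannot bind: every term with i >= 1 has the negative argument m - i (t + 1). *)
Lemma bounded_compositions_small (t s m : nat) :
  (m <= t)%N -> bounded_compositions t.+1 s m%:Z = weak_compositions s m%:Z.
Proof.
move=> le_mt; rewrite bounded_compositionsE big_nat_recl // big1_seq ?addr0.
  by rewrite signed_bin0 mul1r; congr weak_compositions; lia.
by move=> i _; rewrite weak_compositions_neg ?mulr0 //; nia.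
Qed.

Lemma bounded_compositions_trunc (r s t m : nat) :
  (r <= s)%N -> (m <= t)%N ->
  bounded_compositions t.+1 s (t%:Z * r%:Z - m%:Z) =
  \sum_(0 <= i < (s - r).+1) signed_bin s i *
    weak_compositions s (t%:Z * (s%:Z - r%:Z - i%:Z) + m%:Z - i%:Z).
Proof.
move=> le_rs le_mt; rewrite bounded_compositions_rev bounded_compositionsE.
rewrite (@big_cat_nat _ _ _ (s - r).+1) //=; last by rewrite ltnS leq_subr.
rewrite [X in _ + X]big1_seq ?addr0 => [|i /=]; last first.
  rewrite mem_index_iota => /andP[lt_i _].
  (* Here i > s - r, so the argument is at most m - t - i < 0. *)
  by rewrite weak_compositions_neg ?mulr0 //; nia.
apply: eq_bigr => i _; congr (_ * weak_compositions _ _).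
rewrite -addn1 PoszD; ring.
Qed.

(** * Peeling a basis off a lattice point *)

Lemma subset_between (T : finType) (A C : {set T}) (k : nat) :
  A \subset C -> (#|A| <= k <= #|C|)%N ->
  exists B : {set T}, [/\ A \subset B, B \subset C & #|B| = k].
Proof.
move=> sAC; elim: k => [|k IHk] /andP[leAk lekC].
  by exists A; split=> //; apply/eqP; rewrite -leqn0.
move: leAk; rewrite leq_eqVlt => /predU1P[cA|leAk]; first by exists A.
have [|B [sAB sBC cB]] := IHk; first by rewrite -ltnS leAk ltnW.
have /subsetPn[x xC xB] : ~~ (C \subset B).
  by apply: contraL lekC => /subset_leq_card; rewrite cB -leqNgt.
exists (x |: B); split; last by rewrite cardsU1 xB cB.
  exact: subset_trans sAB (subsetUr _ _).
by rewrite subUset sub1set xC.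
Qed.

(* [k] is the average of [z] over [t.+1] layers, rounded either way. *)
Lemma balanced_layer (T : finType) (S : {set T}) (z : T -> nat) (t k : nat) :
  (forall i, z i <= t.+1)%N ->
  (\sum_(i in S) z i < k.+1 * t.+1)%N ->
  (k * t.+1 < \sum_(i in S) z i + t.+1)%N ->
  exists B : {set T}, [/\ B \subset S, #|B| = k &
    forall i, i \in S -> ((i \in B) <= z i <= t + (i \in B))%N].
Proof.
move=> z_le lt_sum gt_sum.
(* B must contain [A], to bring every entry down to t, and lie in [C], to keep entries
   nonnegative. *)
pose A := [set i in S | z i == t.+1]; pose C := [set i in S | (0 < z i)%N].
have leA : (#|A| * t.+1 <= \sum_(i in S) z i)%N.
  rewrite -sum_nat_const [leqRHS](big_setID A) /=.
  have /setIidPr -> : A \subset S by apply/subsetP => i; rewrite inE => /andP[].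
  apply: leq_trans (leq_addr _ _); apply: leq_sum => i.
  by rewrite inE => /andP[_ /eqP->].
have leC : (\sum_(i in S) z i <= #|C| * t.+1)%N.
  rewrite -sum_nat_const [leqLHS](big_setID C) /=.
  have /setIidPr -> : C \subset S by apply/subsetP => i; rewrite inE => /andP[].
  rewrite [X in (_ + X)%N]big1 ?addn0; first exact: leq_sum.
  by move=> i; rewrite !inE; lia.
have [||B [sAB sBC cB]] := @subset_between T A C k.
- by apply/subsetP => i; rewrite !inE => /andP[-> /eqP->].
(* Compare |A| (t + 1) <= sum < (k + 1) (t + 1) and k (t + 1) < sum + t + 1 <= (|C| + 1) (t + 1). *)
- by apply/andP; split; rewrite -ltnS -(@ltn_pmul2r t.+1) //; lia.
exists B; split=> // [|i iS].
  by apply: subset_trans sBC _; apply/subsetP => i; rewrite inE => /andP[].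
have := subsetP sAB i; have := subsetP sBC i; have := z_le i.
rewrite !inE iS /=.
case: (i \in B) => /= z_i hC hA; first by rewrite hC // addn1.
by rewrite addn0 -ltnS ltn_neqAle z_i andbT; apply/negP => /hA.
Qed.

(** The inequalities of the t-th dilate; nonnegativity is carried by the type of z. *)
Definition pan_point (r s n t : nat) (z : 'I_n -> nat) : bool :=
  [&& [forall i, z i <= t]%N, (\sum_i z i == t * r)%N
    & (\sum_(i | i \notin initial_segment s n) z i <= t)%N].

Lemma pan_point_peel (r s n t : nat) (z : 'I_n -> nat) :
  pan_point r s n t.+1 z ->
  exists B : {set 'I_n}, [/\ B \in pan_bases r s n,
    forall i, ((i \in B) <= z i)%N
    & pan_point r s n t (fun i => z i - (i \in B))%N].
Proof.
case/and3P => /forallP z_le /eqP sum_z tail_z.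
set S := initial_segment s n in tail_z *.
have sum_split : ((\sum_(i in S) z i) + (\sum_(i in ~: S) z i) = t.+1 * r)%N.
  rewrite -sum_z [RHS](bigID (mem S)) /=; congr (_ + _)%N.
  by apply: eq_bigl => i; rewrite !inE.
have tail_eq : (\sum_(i | i \notin S) z i = \sum_(i in ~: S) z i)%N.
  by apply: eq_bigl => i; rewrite !inE.
rewrite tail_eq in tail_z.
(* The tail average over t.+1 layers is at most 1; [k] is its floor, so the basis uses a tail
   element only when the tail bound is attained. *)
pose k := (\sum_(i in ~: S) z i == t.+1)%N.
have [||B2 [sB2 cB2 hB2]] := @balanced_layer _ (~: S) z t k z_le.
- rewrite /k; case: eqP => [->|]; lia.
- rewrite /k; case: eqP => [->|]; lia.
(* A tail sum of t.+1 forces r > 0, the total being t.+1 * r. *)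
have le_kr : (k <= r)%N by rewrite /k; case: eqP => // ?; nia.
(* The head average is r minus the tail average, so r - k is its ceiling. *)
have [||B1 [sB1 cB1 hB1]] := @balanced_layer _ S z t (r - k) z_le.
- move: le_kr; rewrite /k; case: eqP => ? ?; nia.
- move: le_kr; rewrite /k; case: eqP => ? ?; nia.
have B12 : B1 :&: B2 = set0.
  apply/eqP; rewrite setI_eq0 disjoints_subset (subset_trans sB1) //.
  by rewrite -setCS setCK.
pose B := B1 :|: B2.
have cB : #|B| = r by rewrite /B cardsU B12 cards0 subn0 cB1 cB2 subnK.
have B_le i : ((i \in B) <= z i <= t + (i \in B))%N.
  have [iS|iS] := boolP (i \in S).
    have -> : i \in B = (i \in B1); last exact: hB1.
    rewrite inE; case: (boolP (i \in B2)) => [/(subsetP sB2)|].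
      by rewrite inE iS.
    by rewrite orbF.
  have -> : i \in B = (i \in B2); last by apply: hB2; rewrite inE.
  rewrite inE; case: (boolP (i \in B1)) => [/(subsetP sB1)|//].
  by rewrite (negPf iS).
exists B; split=> [|i|]; last 1 first.
- apply/and3P; split.
  + by apply/forallP => i; have := B_le i; lia.
  + rewrite sumnB => [|i _]; last by case/andP: (B_le i).
    have -> : (\sum_i (i \in B) = r)%N.
      by rewrite -cB -sum1_card [RHS]big_mkcond; apply: eq_bigr => i _;
        case: (_ \in _).
    by rewrite sum_z mulSn addKn.
  + rewrite sumnB => [|i _]; last by case/andP: (B_le i).
    have -> : (\sum_(i | i \notin S) (i \in B) = k)%N.
      rewrite -cB2 -sum1_card big_mkcond [RHS]big_mkcond; apply: eq_bigr => i _.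
      rewrite in_setU; have := subsetP sB1 i; have := subsetP sB2 i.
      rewrite in_setC.
      case: (i \in B1); case: (i \in B2); case: (i \in S) => //= h1 h2;
        by [have := h1 isT | have := h2 isT].
    apply: leq_trans (leq_sub2r _ (eq_leq tail_eq)) _.
    by move: tail_z; rewrite /k; case: eqP; lia.
- rewrite inE cB eqxx /=.
  have : (#|B1| <= #|B :&: S|)%N.
    by apply: subset_leq_card; rewrite subsetI sB1 subsetUl.
  rewrite cB1 leq_subLR -/S => /leq_trans; apply.
  by rewrite -add1n leq_add2r leq_b1.
- by case/andP: (B_le i).
Qed.

(* The base polytope and its linear conditions *)
From mathcomp Require Import finmap boolp classical_sets cardinality.
From mathcomp Require Import reals interval_inference convex.

Lemma convex_hull_conv (R : realType) (n : nat) (X : set 'rV[R]_n)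
    (x y : 'rV[R]_n) (l : R) : 0 <= l <= 1 ->
  convex_hull X x -> convex_hull X y -> convex_hull X (l *: x + (1 - l) *: y).
Proof.
case/andP => l_ge0 l_le1 Xx Xy A [cA sXA].
have := cA x y (Itv01 l_ge0 l_le1).
by rewrite !in_setE; apply; [apply: Xx | apply: Xy].
Qed.

Lemma indicator_vectorE (R : realType) (n : nat) (B : {set 'I_n}) i :
  indicator_vector R B 0 i = (i \in B)%:R.
Proof.
rewrite summxE (eq_bigr (fun j => (i == j)%:R)) => [|j _]; last by rewrite mxE.
case: (boolP (i \in B)) => [iB|iB].
  rewrite (bigD1 i) //= eqxx big1 ?addr0 // => j /andP[_ /negPf].
  by rewrite eq_sym => ->.
by rewrite big1 // => j jB; case: eqP => // eij; rewrite eij jB in iB.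
Qed.

Lemma sum_indicator_vector (R : realType) (n : nat) (B : {set 'I_n})
    (P : pred 'I_n) :
  \sum_(i | P i) indicator_vector R B 0 i = #|[set i in B | P i]|%:R.
Proof.
rewrite -sum1_card natr_sum big_mkcond [RHS]big_mkcond; apply: eq_bigr => i _.
by rewrite indicator_vectorE inE; case: (i \in B); case: (P i).
Qed.

Lemma base_polytope_indicator (R : realType) (n : nat) (M : matroid 'I_n)
  (B : {set 'I_n}) : B \in bases M -> base_polytope M (indicator_vector R B).
Proof. by move=> MB; apply: sub_gen_smallest; exists B. Qed.

(** Peeling off B leaves t x with x in the polytope, and t x + e_B is t + 1 times the convex
    combination of x and e_B with weights t / (t + 1) and 1 / (t + 1). *)
Lemma pan_point_dilate (R : realType) (r s n : nat)
    (le_rs : (r <= s)%N) (lt_sn : (s < n)%N) (t : nat) (z : 'I_n -> nat) :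
  pan_point r s n t z ->
  exists2 x, @base_polytope R n (pan le_rs lt_sn) x
    & \row_i (z i)%:R = t%:R *: x.
Proof.
elim: t z => [|t IHt] z.
  case/and3P => /forallP z_le _ _.
  (* The zero vector is 0 times any point, so all that is needed is a nonempty polytope. *)
  have /set0Pn[B MB] := bases_neq0 (pan le_rs lt_sn).
  exists (indicator_vector R B); first exact: base_polytope_indicator.
  rewrite scale0r; apply/rowP => i; rewrite !mxE.
  by have := z_le i; rewrite leqn0 => /eqP->.
case/pan_point_peel => B [MB leB /IHt[x Px xE]].
have t1_neq0 : t.+1%:R != 0 :> R by rewrite pnatr_eq0.
exists (t%:R / t.+1%:R *: x + (1 - t%:R / t.+1%:R) *: indicator_vector R B).
  apply: convex_hull_conv => //; last exact: base_polytope_indicator.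
  by rewrite divr_ge0 ?ler0n // ler_pdivrMr ?ltr0n // mul1r ler_nat leqnSn.
rewrite scalerDr !scalerA mulrBr mulrCA divff // !mulr1 -xE.
apply/rowP => i; have := indicator_vectorE R n B i.
rewrite !mxE => ->.
by rewrite natrB // -natr1; ring.
Qed.

(** The conditions define a convex set [C] containing the generators, and the hull is the smallest
    such set. *)
Lemma base_polytope_pan (R : realType) (r s n : nat)
    (le_rs : (r <= s)%N) (lt_sn : (s < n)%N) (x : 'rV[R]_n) :
  @base_polytope R n (pan le_rs lt_sn) x ->
  [/\ forall i, 0 <= x 0 i <= 1, \sum_i x 0 i = r%:R
    & \sum_(i | i \notin initial_segment s n) x 0 i <= 1].
Proof.
pose C : set 'rV[R]_n :=
  [set x : 'rV[R]_n | [/\ forall i, 0 <= x 0 i <= 1, \sum_i x 0 i = r%:R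
    & \sum_(i | i \notin initial_segment s n) x 0 i <= 1]]%classic.
suff : (@base_polytope R n (pan le_rs lt_sn) `<=` C)%classic by apply.
apply: smallest_sub => [y z l|_ [B /= MB <-]].
  rewrite !in_setE => -[y01 sum_y tail_y] [z01 sum_z tail_z].
  have c_ge0 : 0 <= l%:num :> R by [].
  have c_le1 : l%:num <= 1 :> R by [].
  set c : R := l%:num in c_ge0 c_le1.
  have convE i : (conv l (y : convex_lmodType 'rV[R]_n) z : 'rV[R]_n) 0 i
      = c * y 0 i + (1 - c) * z 0 i.
    by rewrite !mxE.
  have conv_le1 (a b : R) : a <= 1 -> b <= 1 -> c * a + (1 - c) * b <= 1.
    move=> a_le1 b_le1; rewrite -[leRHS](addrNK c 1) [leRHS]addrC.
    by rewrite lerD ?ler_piMr ?subr_ge0.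
  split.
  - by move=> i; rewrite convE addr_ge0 ?conv_le1 ?mulr_ge0 ?subr_ge0 //;
      have /andP[] := y01 i; have /andP[] := z01 i.
  - rewrite (eq_bigr _ (fun i _ => convE i)) big_split /= -!mulr_sumr.
    by rewrite sum_y sum_z; ring.
  - rewrite (eq_bigr _ (fun i _ => convE i)) big_split /= -!mulr_sumr.
    exact: conv_le1.
move: MB; rewrite inE => /andP[/eqP cB tailB].
split.
- by move=> i; rewrite indicator_vectorE; case: (_ \in _); rewrite ?lexx ler01.
- rewrite sum_indicator_vector -cB; congr (_%:R).
  by apply: eq_card => i; rewrite !inE andbT.
- rewrite sum_indicator_vector lern1.
  (* A basis has r elements, at least r - 1 of them in the head, hence at most one in the tail. *)
  have := cardsID (initial_segment s n) B; rewrite cB.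
  have -> : [set i in B | i \notin initial_segment s n]
      = B :\: initial_segment s n.
    by apply/setP => i; rewrite !inE andbC.
  by move: tailB; lia.
Qed.

(** * Lattice points as rows in the finite box [0, t]^n *)

Definition int_row {t n : nat} (u : 'rV['I_t.+1]_n) : 'rV[int]_n :=
  map_mx (fun i : 'I_t.+1 => (i : nat)%:Z) u.

Lemma int_row_inj (t n : nat) : injective (@int_row t n).
Proof.
move=> u v /rowP uv; apply/rowP => i; apply: val_inj.
by have := uv i; rewrite !mxE => -[].
Qed.

Lemma lattice_points_pan (R : realType) (r s n : nat)
    (le_rs : (r <= s)%N) (lt_sn : (s < n)%N) (t : nat) (z : 'rV[int]_n) :
  lattice_points
    [set t%:R *: x | x in @base_polytope R n (pan le_rs lt_sn)]%classic z <->
  exists2 u : 'rV['I_t.+1]_n,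
    pan_point r s n t (fun i => u 0 i) & int_row u = z.
Proof.
split=> [[x Px xz]|[u pan_u <-]]; last first.
  have [x Px xE] := @pan_point_dilate R r s n le_rs lt_sn t _ pan_u.
  by exists x => //; rewrite -xE; apply/rowP => i; rewrite !mxE.
have [x01 sum_x tail_x] := @base_polytope_pan R r s n le_rs lt_sn x Px.
have zE i : (z 0 i)%:~R = t%:R * x 0 i by have /rowP/(_ i) := xz; rewrite !mxE.
have z_bounds i : 0 <= z 0 i <= t%:Z.
  have /andP[x_ge0 x_le1] := x01 i.
  rewrite -!(ler_int R) zE mulr_ge0 //=.
  by rewrite -[leRHS]mulr1 ler_wpM2l.
(* By [z_bounds], neither the absolute value nor the default of [inord] alters an entry. *)
pose u : 'rV['I_t.+1]_n := \row_i inord `|z 0%R i|%N.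
have uE i : (u 0 i : nat)%:Z = z 0 i.
  have /andP[z_ge0 z_le] := z_bounds i; rewrite mxE inordK; last lia.
  by rewrite gez0_abs.
have uR i : (u 0 i : nat)%:R = t%:R * x 0 i by rewrite -zE -uE.
exists u; last by apply/rowP => i; rewrite mxE uE.
apply/and3P; split.
- by apply/forallP => i; rewrite -ltnS.
- rewrite -(eqr_nat R) natr_sum (eq_bigr _ (fun i _ => uR i)) -mulr_sumr sum_x.
  by rewrite natrM.
- rewrite -(ler_nat R) natr_sum (eq_bigr _ (fun i _ => uR i)) -mulr_sumr.
  by rewrite -[leRHS]mulr1 ler_wpM2l.
Qed.

(** The lattice points are the injective image of a finite set of rows, so [fset_set] takes its true
    value and not the default. *)
Lemma ehrhart_pan (R : realType) (r s n : nat)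
    (le_rs : (r <= s)%N) (lt_sn : (s < n)%N) (t : nat) :
  ehrhart R (pan le_rs lt_sn) t
    = #|[pred u : 'rV['I_t.+1]_n | pan_point r s n t (fun i => u 0 i)]|.
Proof.
set A := [pred u | _].
have -> : ehrhart R (pan le_rs lt_sn) t = #|` [fset int_row u | u in A]%fset |.
  rewrite /ehrhart; congr #|` _|; rewrite -[RHS]set_fsetK; congr fset_set.
  apply/seteqP; split=> z /=.
    move/lattice_points_pan => [u Au <-]; apply/imfsetP; exists u => //.
  by move/imfsetP => [u Au ->]; apply/lattice_points_pan; exists u.
rewrite card_imfset; last exact: int_row_inj.
by rewrite cardE.
Qed.

(** Cut a row into head and tail and sort by the tail sum m: the head then has sum t r - m, and the
    two pieces are otherwise independent. *)
Lemma card_pan_points (r s d t : nat) :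
  #|[pred u : 'rV['I_t.+1]_(s + d) |
      pan_point r s (s + d) t (fun i => u 0 i)]|%:Z
  = \sum_(0 <= m < t.+1) bounded_compositions t.+1 s (t%:Z * r%:Z - m%:Z)
      * bounded_compositions t.+1 d m%:Z.
Proof.
transitivity (\sum_(u : 'rV['I_t.+1]_(s + d))
   (pan_point r s (s + d) t (fun i => u 0 i) : nat)%:Z).
  rewrite -sum1_card -natz natr_sum big_mkcond; apply: eq_bigr => u _.
  by rewrite inE; case: (pan_point _ _ _ _ _).
pose F (v : 'rV['I_t.+1]_s) (w : 'rV['I_t.+1]_d) : int :=
  ((weight v + weight w == t%:Z * r%:Z) && (weight w <= t%:Z))%:Z.
have panE (u : 'rV['I_t.+1]_(s + d)) :
    (pan_point r s (s + d) t (fun i => u 0 i) : nat)%:Z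
      = F (lsubmx u) (rsubmx u).
  congr (nat_of_bool _)%:Z.
  rewrite /pan_point -weight_split.
  have -> : [forall i, (u 0%R i <= t)%N] by apply/forallP => i; rewrite -ltnS.
  have -> : weight (rsubmx u)
      = (\sum_(i | i \notin initial_segment s (s + d)) u 0%R i)%N%:Z.
    rewrite -natz natr_sum /weight big_split_ord /=.
    rewrite [X in _ = X + _]big_pred0 ?add0r => [|i]; last first.
      by rewrite inE /= ltn_ord.
    by apply: eq_big => [i|i _]; rewrite ?inE /= ?mxE ?natz // -leqNgt leq_addr.
  have -> : weight u = (\sum_i u 0%R i)%N%:Z.
    by rewrite -natz natr_sum; apply: eq_bigr => i _; rewrite natz.
  by rewrite /= lez_nat -PoszM.
rewrite (eq_bigr _ (fun u _ => panE u)) big_row_split exchange_big /=.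
rewrite [RHS]big_mkord.
under [RHS]eq_bigr => m _ do rewrite mulr_sumr.
rewrite [RHS]exchange_big; apply: eq_bigr => w _ /=.
have w_ge0 : 0 <= weight w by apply: sumr_ge0 => i _.
(* A tail [w] of weight at most t contributes only at m = [weight w]; a heavier one contributes to
   neither side. *)
have [le_wt|lt_tw] := lerP (weight w) t%:Z.
  have lt_w : (`|weight w| < t.+1)%N by lia.
  rewrite [RHS](bigD1 (Ordinal lt_w)) //= [X in _ = _ + X]big1 => [|m ne_m].
    rewrite gez0_abs // eqxx mulr1 addr0; apply: eq_bigr => v _.
    by rewrite /F le_wt andbT; congr (nat_of_bool _)%:Z; lia.
  have -> : (weight w == m%:Z) = false; last by rewrite mulr0.
  by apply: contra_neqF ne_m => /eqP wm; apply: val_inj; rewrite /= wm.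
rewrite !big1 // => [m _|v _]; last by rewrite /F [_ <= _]leNgt lt_tw andbF.
have -> : (weight w == m%:Z) = false; last by rewrite mulr0.
by have := ltn_ord m; lia.
Qed.

Theorem theorem5p2 (R : realType) (r s n : nat)
    (le_rs : (r <= s)%N) (lt_sn : (s < n)%N) (t : nat) :
  (ehrhart R (pan le_rs lt_sn) t)%:Z =
  \sum_(0 <= m < t.+1) \sum_(0 <= i < (s - r).+1)
    (-1) ^+ i * binz s%:Z i%:Z
      * binz (t%:Z * (s%:Z - r%:Z - i%:Z) + m%:Z + s%:Z - 1 - i%:Z) (s%:Z - 1)
      * binz (m%:Z + n%:Z - s%:Z - 1) m%:Z.
Proof.
rewrite ehrhart_pan.
have [d nE] : exists d, n = (s + d.+1)%N by exists (n - s.+1)%N; lia.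
subst n; rewrite card_pan_points; apply: eq_big_nat => m /andP[_ le_mt].
rewrite bounded_compositions_small // bounded_compositions_trunc // mulr_suml.
(* As s < n the tail is nonempty and both upper indices are the natural number m + d; symmetry then
   exchanges the lower indices d and m. *)
have -> : weak_compositions d.+1 m%:Z
    = binz (m%:Z + (s + d.+1)%N%:Z - s%:Z - 1) m%:Z.
  rewrite /weak_compositions.
  have -> : m%:Z + d.+1%:Z - 1 = (m + d)%N%:Z by lia.
  have -> : m%:Z + (s + d.+1)%N%:Z - s%:Z - 1 = (m + d)%N%:Z by lia.
  have -> : d.+1%:Z - 1 = d%:Z by lia.
  by rewrite /= -bin_sub ?leq_addl // addnK.
apply: eq_bigr => i _; rewrite /signed_bin /weak_compositions.
congr (_ * _); congr (_ * binz _ _); ring.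
Qed.
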